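(* Let $\Phi$ be a random formula drawn from the weighted geometric model on $\mathbb T^d$ equipped with a $\mathfrak p$-norm, with temperature $0<T<1$, and with $\max_{v}w_v/W\in o(1)$. Then each clause $c$ of $\Phi$ is nice with probability $\Omega(1)$ (bounded below by a positive constant for all sufficiently large $n$). Consequently the expected number of nice clauses of $\Phi$ is $\Theta(m)$.
   Context: $\mathbb T^d$ is $[0,1]^d$ with opposite faces identified ($d$ a fixed constant), with distance $\mathrm{dist}(p,q)=\left(\sum_{i=1}^d|p_i-q_i|_\circ^{\mathfrak p}\right)^{1/\mathfrak p}$ (and $\max_i|p_i-q_i|_\circ$ for $\mathfrak p=\infty$), where $|a-b|_\circ=\min\{|a-b|,1-|a-b|\}$ and $\mathfrak p\in\mathbb N^+\cup\{\infty\}$ is fixed. Weighted geometric $k$-SAT model ($k$ constant): $n$ variables with weights $w_v\ge1$, minimum $1$, total $W=\sum_v w_v$, and $m$ clauses; all get independent uniformly random positions in $\mathbb T^d$. Connection weight $X(c,v)=\left(w_v/\mathrm{dist}(c,v)^d\right)^{1/T}$. Each clause draws $k$ variables one after another without repetition, each draw among the remaining variables with probability proportional to $X(c,v)$; signs are chosen among the $2^k$ patterns (details irrelevant here). A clause $c$ is nice if, for each $j\in[k]$, the $j$-th variable drawn for $c$ is the variable with the $j$-th highest connection weight with $c$. *)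

(* Defs.v *)
From HB Require Import structures.
From mathcomp Require Import all_boot all_order all_algebra.
From mathcomp Require Import all_classical all_reals.
From mathcomp Require Import ereal topology normedtype sequences exp measure
  lebesgue_measure lebesgue_integral.
Set Implicit Arguments. Unset Strict Implicit. Unset Printing Implicit Defensive.
Import Order.TTheory GRing.Theory Num.Theory.
Local Open Scope classical_set_scope.
Local Open Scope ring_scope.

Section Model.
Variable R : realType.

(* A point of the torus T^d is given by its coordinates (only those < d are used). *)
Definition circ_dist (a b : R) : R := Num.min `|a - b| (1 - `|a - b|).

Definition torus_dist (d : nat) (pn : option nat) (x y : nat -> R) : R :=
  match pn with
  | Some p => powR (\sum_(i < d) circ_dist (x i) (y i) ^+ p) (p%:R^-1)
  | None => \big[Num.max/0]_(i < d) circ_dist (x i) (y i)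
  end.

Definition conn_weight (d : nat) (pn : option nat) (T : R) (wv : R)
  (c xv : nat -> R) : R :=
  powR (wv / torus_dist d pn c xv ^+ d) (T^-1).

(* Probability, given positions and weights Xc (Xc v = X(c,v)), that drawing k
   variables one after another without repetition, each proportionally to Xc
   among the remaining ones, yields exactly the sequence u. *)
Definition draw_prob (n k : nat) (Xc : 'I_n -> R) (u : {ffun 'I_k -> 'I_n}) : R :=
  \prod_(j < k)
     (Xc (u j) / \sum_(v < n | [forall j' : 'I_k, (j' < j)%N ==> (v != u j')]) Xc v).

(* the drawn sequence u is "nice": for each j, the j-th drawn variable is the one
   with the j-th highest connection weight *)
Definition nice_seq (n k : nat) (Xc : 'I_n -> R) (u : {ffun 'I_k -> 'I_n}) : bool :=
  [forall j : 'I_k, forall v : 'I_n,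
     [forall j' : 'I_k, (j' <= j)%N ==> (v != u j')] ==> (Xc v < Xc (u j))].

Definition nice_prob_given (n k d : nat) (pn : option nat) (T : R) (w : 'I_n -> R)
  (c : nat -> R) (x : 'I_n -> nat -> R) : R :=
  let Xc := fun v => conn_weight d pn T (w v) c (x v) in
  \sum_(u : {ffun 'I_k -> 'I_n} | injectiveb u && nice_seq Xc u) draw_prob Xc u.

Fixpoint cube_int (D : nat) (f : (nat -> R) -> \bar R) : \bar R :=
  match D with
  | 0 => f (fun _ => 0)
  | D'.+1 => (\int[@lebesgue_measure R]_(t in `[0%R, 1%R]%classic)
                 cube_int D' (fun g => f (fun i => if i == D' then t else g i)))%E
  end.

Definition var_pos (d : nat) (n : nat) (g : nat -> R) (v : 'I_n) : nat -> R :=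
  fun i => g (v * d + i)%N.
Definition clause_pos (d : nat) (n m : nat) (g : nat -> R) (j : 'I_m) : nat -> R :=
  fun i => g ((n + j) * d + i)%N.

Definition clause_nice_prob (n m k d : nat) (pn : option nat) (T : R)
  (w : 'I_n -> R) (j : 'I_m) : \bar R :=
  cube_int ((n + m) * d)
    (fun g => (nice_prob_given k d pn T w (clause_pos d n g j) (var_pos d g))%:E).

Definition expected_nice (n m k d : nat) (pn : option nat) (T : R)
  (w : 'I_n -> R) : \bar R :=
  cube_int ((n + m) * d)
    (fun g => (\sum_(j < m)
       nice_prob_given k d pn T w (clause_pos d n g j) (var_pos d g))%:E).

End Model.

(* Main.v *)
(* Write W for the total weight, r v = (w v / W)^(1/d) for the radius of a variable,
   and Y v = (r v / dist)^(d/T), so that X(c,v) = W^(1/T) Y v. Fix a clause position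
   and k distinct variables u_1, ..., u_k. If u_j lies in the shell of order
   (3d)^j r(u_j) around the clause and every other variable v is further away than
   (3d)^k r(v), then (u_j) is the nice sequence, and it is drawn with probability at
   least a constant times prod_v exp(- Y v), v ranging over the other variables: the
   denominators are at most k + S with S = sum_v Y v, and k / (k + S) >= exp(- S / k).
   This minorant is a product over the variables, so it can be integrated variable by
   variable. A shell has volume at least w v / W; a dyadic decomposition, whose
   geometric series converges because T < 1, shows that the factor of each other
   variable integrates to at least 1 - A w v / W >= exp(- 2 A w v / W). The sum over
   u of prod_j w(u_j) / W over injective u is at least 1 - k^2 max w / W. *)
Require Import Defs.
From HB Require Import structures.
From mathcomp Require Import all_boot all_order all_algebra.
From mathcomp Require Import all_classical all_reals.
From mathcomp Require Import ereal topology normedtype sequences exp measure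
  lebesgue_measure lebesgue_integral.
From mathcomp Require Import numfun measurable_realfun.
From mathcomp Require Import ring lra.
Set Implicit Arguments.
Unset Strict Implicit.
Unset Printing Implicit Defensive.
Import Order.TTheory GRing.Theory Num.Theory.
Local Open Scope classical_set_scope.
Local Open Scope ring_scope.

(** * Monotonicity, superadditivity and scaling of the lower integral *)

(* [integral] is a supremum over simple functions, that is, a lower integral, so
   the inequalities of this section need no measurability. *)
Section LowerIntegral.
Import HBNNSimple.
Context d (T : measurableType d) (R : realType) (mu : {measure set T -> \bar R}).
Local Open Scope ereal_scope.

Lemma le_integral_nomeas (D : set T) (f g : T -> \bar R) :
  (forall x, D x -> f x <= g x) ->
  \int[mu]_(x in D) f x <= \int[mu]_(x in D) g x.
Proof.
move=> fg.
have fgD x : (f \_ D) x <= (g \_ D) x.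
  by rewrite /patch; case: ifPn => // /set_mem; exact: fg.
rewrite /integral; apply: leeB; apply: ereal_sup_le.
- move=> _ /= [h hf <-]; exists h => // x.
  apply: (le_trans (hf x)); rewrite !funeposE ge_max le_max fgD /=.
  by rewrite le_max lexx orbT.
- move=> _ /= [h hf <-]; exists h => // x.
  apply: (le_trans (hf x)); rewrite !funenegE ge_max le_max leeN2 fgD /=.
  by rewrite le_max lexx orbT.
Qed.

(** A simple minorant of [f] plus one of [g] is a simple minorant of the sum. Without measurability
    only this half of additivity holds in general. *)
Lemma ge0_integral_superadd (D : set T) (f g : T -> \bar R) :
  (forall x, D x -> 0 <= f x) -> (forall x, D x -> 0 <= g x) ->
  \int[mu]_(x in D) f x + \int[mu]_(x in D) g x <=
  \int[mu]_(x in D) (f x + g x).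
Proof.
move=> f0 g0.
have fg0 x : D x -> 0 <= f x + g x by move=> Dx; rewrite adde_ge0 ?f0 ?g0.
have If0 : 0 <= \int[mu]_(x in D) f x by exact: integral_ge0.
have Ig0 : 0 <= \int[mu]_(x in D) g x by exact: integral_ge0.
have key (h1 h2 : {nnsfun T >-> R}) :
    (forall x, (h1 x)%:E <= (f \_ D) x) -> (forall x, (h2 x)%:E <= (g \_ D) x) ->
    sintegral mu h1 + sintegral mu h2 <= \int[mu]_(x in D) (f x + g x).
  move=> h1f h2g; rewrite [leRHS]ge0_integralE// -sintegralD.
  apply: ereal_sup_ubound; exists (add_nnsfun h1 h2) => //= x.
  rewrite EFinD; apply: (le_trans (leeD (h1f x) (h2g x))).
  by rewrite /patch; case: ifPn; rewrite ?adde0.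
(* An infinite right side leaves nothing to prove. Otherwise all terms are finite, subtraction is
   legitimate, and the two suprema can be taken one after the other. *)
have [->|ltI] := eqVneq (\int[mu]_(x in D) (f x + g x)) +oo; first exact: leey.
have finI x : 0 <= x -> x <= \int[mu]_(x in D) (f x + g x) -> x \is a fin_num.
  move=> x0 xI; rewrite ge0_fin_numE//; apply: (le_lt_trans xI).
  by rewrite ltey.
have le_fI : \int[mu]_(x in D) f x <= \int[mu]_(x in D) (f x + g x).
  by apply: le_integral_nomeas => x Dx; rewrite leeDl ?g0.
rewrite -leeBrDl ?finI// [leLHS]ge0_integralE//.
apply: ge_ereal_sup => _ [h2 h2g <-].
have s2 : sintegral mu h2 \is a fin_num.
  apply: finI; first exact: sintegral_ge0.
  rewrite -[leLHS]add0e -(sintegral0 mu).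
  by apply: (key (cst_nnsfun T (NngNum (lexx 0%R))) h2) => // x; rewrite /= erestrict_ge0.
rewrite leeBrDl ?finI// -leeBrDr// [leLHS]ge0_integralE//.
apply: ge_ereal_sup => _ [h1 h1f <-].
by rewrite leeBrDr//; exact: key.
Qed.

Lemma ge0_integral_scale_le (D : set T) (f : T -> \bar R) (a : R) :
  (0 <= a)%R -> (forall x, D x -> 0 <= f x) ->
  a%:E * \int[mu]_(x in D) f x <= \int[mu]_(x in D) (a%:E * f x).
Proof.
move=> a0 f0.
have [->|aN0] := eqVneq a 0%R.
  rewrite mul0e; apply: integral_ge0 => x Dx; by rewrite mul0e.
have a_gt0 : (0 < a)%R by rewrite lt0r aN0.
rewrite -lee_pdivlMl// [leLHS]ge0_integralE//.
apply: ge_ereal_sup => _ [h hf <-].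
rewrite lee_pdivlMl// ge0_integralE; last first.
  by move=> x Dx; rewrite mule_ge0// ?f0// lee_fin.
rewrite -sintegralrM.
apply: ereal_sup_ubound; exists (scale_nnsfun h a0) => //= x.
rewrite EFinM; apply: (@le_trans _ _ (a%:E * (f \_ D) x)).
  by rewrite lee_pmul2l ?fin_numE.
by rewrite /patch; case: ifPn; rewrite ?mule0.
Qed.
End LowerIntegral.

(** * Iterated lower integrals over the unit cube *)

Section CubeIntegral.
Context {R : realType}.
Implicit Types (f : (nat -> R) -> \bar R) (g x : nat -> R) (D : nat).

(** All coordinates are constrained, also those never integrated: [cube_int] leaves them at 0, which
    is in range. *)
Definition in_cube g := forall i, 0 <= g i <= 1.

Lemma le_cube_int D f1 f2 : (forall g, in_cube g -> (f1 g <= f2 g)%E) ->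
  (cube_int D f1 <= cube_int D f2)%E.
Proof.
elim: D f1 f2 => [|D IH] f1 f2 f12 /=.
  by apply: f12 => i; rewrite lexx ler01.
apply: le_integral_nomeas => t; rewrite /= in_itv /= => t01.
by apply: IH => g gc; apply: f12 => i; case: ifP.
Qed.

Lemma lebesgue_measure_unit_itv :
  @lebesgue_measure R `[0%R, 1%R]%classic = 1%E.
Proof. by rewrite lebesgue_measure_itv /= lte_fin ltr01 sube0. Qed.

Lemma cube_int_cst D (c : R) : cube_int D (fun=> c%:E) = c%:E.
Proof.
elim: D => [//|D IH] /=; rewrite (eq_integral (cst c%:E)); last by [].
by rewrite integral_cst//= lebesgue_measure_unit_itv mule1.
Qed.

Lemma cube_int_ge0 D f : (forall g, in_cube g -> (0 <= f g)%E) ->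
  (0 <= cube_int D f)%E.
Proof.
by move=> f0; have := le_cube_int D f0; rewrite (cube_int_cst D 0).
Qed.

Lemma cube_int_superadd D f1 f2 :
  (forall g, in_cube g -> (0 <= f1 g)%E) ->
  (forall g, in_cube g -> (0 <= f2 g)%E) ->
  (cube_int D f1 + cube_int D f2 <= cube_int D (fun g => f1 g + f2 g))%E.
Proof.
elim: D f1 f2 => [|D IH] f1 f2 f10 f20 //=.
have step (f : (nat -> R) -> \bar R) t : (forall g, in_cube g -> (0 <= f g)%E) ->
    (`[0, 1]%classic : set R) t ->
    forall g, in_cube g -> (0 <= f (fun i => if i == D then t else g i))%E.
  by rewrite /= in_itv /= => f0 t01 g gc; apply: f0 => i; case: ifP.
apply: le_trans (ge0_integral_superadd _ _ _) _ => [t t01|t t01|].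
- by apply: cube_int_ge0; exact: step.
- by apply: cube_int_ge0; exact: step.
- by apply: le_integral_nomeas => t t01; apply: IH; exact: step.
Qed.

Lemma cube_int_scale_le D f (a : R) : 0 <= a ->
  (forall g, in_cube g -> (0 <= f g)%E) ->
  (a%:E * cube_int D f <= cube_int D (fun g => a%:E * f g))%E.
Proof.
move=> a0; elim: D f => [|D IH] f f0 //=.
have step t : (`[0, 1]%classic : set R) t ->
    forall g, in_cube g -> (0 <= f (fun i => if i == D then t else g i))%E.
  by rewrite /= in_itv /= => t01 g gc; apply: f0 => i; case: ifP.
apply: le_trans (ge0_integral_scale_le _ a0 _) _ => [t t01|].
- by apply: cube_int_ge0; exact: step.
- by apply: le_integral_nomeas => t t01; apply: IH; exact: step.
Qed.

Lemma cube_int_sum_ge D (I : Type) (s : seq I) (P : pred I)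
    (f : I -> (nat -> R) -> R) (p : I -> R) :
  (forall i g, P i -> in_cube g -> 0 <= f i g) ->
  (forall i, P i -> ((p i)%:E <= cube_int D (fun g => (f i g)%:E))%E) ->
  ((\sum_(i <- s | P i) p i)%:E <=
    cube_int D (fun g => (\sum_(i <- s | P i) f i g)%:E))%E.
Proof.
move=> f0 pf; elim: s => [|i s IH].
  have -> : (fun g => (\sum_(i <- [::] | P i) f i g)%:E) = fun=> 0%:E.
    by apply/funext => g; rewrite big_nil.
  by rewrite big_nil cube_int_cst.
have -> : (fun g => (\sum_(j <- i :: s | P j) f j g)%:E) =
    (fun g => if P i then (f i g)%:E + (\sum_(j <- s | P j) f j g)%:E
              else (\sum_(j <- s | P j) f j g)%:E)%E.
  by apply/funext => g; rewrite big_cons; case: ifP.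
rewrite big_cons; case: ifP => // Pi; rewrite EFinD.
apply: le_trans (leeD (pf i Pi) IH) _.
apply: cube_int_superadd => g gc; rewrite lee_fin.
  exact: f0.
by apply: sumr_ge0 => l Pl; exact: f0.
Qed.

(** The outermost integral is over the highest coordinate, so the split keeps the order of
    integration and needs no Fubini theorem. *)
Lemma cube_int_split D1 D2 f : cube_int (D2 + D1) f =
  cube_int D2 (fun h => cube_int D1 (fun g =>
    f (fun i => if (i < D1)%N then g i else h (i - D1)%N))).
Proof.
elim: D2 f => [|D2 IH] f /=.
  rewrite add0n; elim: D1 f => [|D1 IH1] f /=; first by congr f; apply/funext.
  apply: eq_integral => t _; rewrite IH1.
  congr (cube_int _ _); apply/funext => g; congr f; apply/funext => i.
  rewrite ltnS; case: ltngtP => //=; by case: ltngtP.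
apply: eq_integral => t _; rewrite IH; congr (cube_int _ _).
apply/funext => h; congr (cube_int _ _); apply/funext => g.
congr f; apply/funext => i; case: ltnP => iD.
  by case: eqP iD => // ->; rewrite ltnNge leq_addl.
by rewrite -{1}(subnK iD) eqn_add2r.
Qed.

(** One half of Fubini for independent blocks of [d] coordinates, by induction on the number of
    blocks. *)
Lemma cube_int_prod_ge d n (F : 'I_n -> (nat -> R) -> R) (p : 'I_n -> R) :
  (forall v x, in_cube x -> 0 <= F v x) -> (forall v, 0 <= p v) ->
  (forall v x y, (forall i, (i < d)%N -> x i = y i) -> F v x = F v y) ->
  (forall v, ((p v)%:E <= cube_int d (fun x => (F v x)%:E))%E) ->
  ((\prod_(v < n) p v)%:E <= cube_int (n * d)
    (fun g => (\prod_(v < n) F v (fun i => g (v * d + i)%N))%:E))%E.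
Proof.
move=> F0 p0 locF pF; elim: n F p F0 p0 locF pF => [|n IH] F p F0 p0 locF pF.
  by rewrite mul0n /= !big_ord0.
pose F' (v : 'I_n) := F (widen_ord (leqnSn n) v).
have {}IH := IH F' _ (fun v => F0 _) (fun v => p0 (widen_ord (leqnSn n) v))
  (fun v => locF _) (fun v => pF _).
rewrite mulSn cube_int_split big_ord_recr/=.
set P := \prod_(v < n) _.
have P0 : 0 <= P by apply: prodr_ge0.
(* The last block is the outer one. The constant [P] moves under the outer integral, then, for fixed
   [h], [F ord_max h] moves under the inner one. *)
apply: (@le_trans _ _ (P%:E * cube_int d (fun x => (F ord_max x)%:E))%E).
  by rewrite EFinM lee_wpmul2l// lee_fin.
apply: le_trans (cube_int_scale_le _ P0 _) _.
  by move=> g gc; rewrite lee_fin F0.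
apply: le_cube_int => h hc.
apply: (@le_trans _ _ ((F ord_max h)%:E * cube_int (n * d)
  (fun g => (\prod_(v < n) F' v (fun i => g (v * d + i)%N))%:E))%E).
  by rewrite muleC lee_wpmul2l// lee_fin F0.
apply: le_trans (cube_int_scale_le _ _ _) _; first exact: F0.
  by move=> g gc; rewrite lee_fin prodr_ge0// => v _; apply: F0 => i.
apply: le_cube_int => g gc; rewrite -EFinM lee_fin big_ord_recr/= mulrC.
rewrite le_eqVlt; apply/orP; left; apply/eqP; congr (_ * _).
  apply: eq_bigr => v _; apply: locF => i id_ /=.
  suff -> : (v * d + i < n * d)%N by [].
  by rewrite (@leq_trans (v.+1 * d))// ?leq_mul2r ?ltn_ord ?orbT// mulSn addnC ltn_add2r.
by apply: locF => i _; rewrite ltnNge leq_addr /= addKn.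
Qed.

(* Linear combinations of products of one-dimensional indicators: for these the
   iterated lower integral is the genuine integral, even with signed coefficients. *)
Lemma cube_int_lincomb_indic D L (a : 'I_L -> R) (A : 'I_L -> nat -> set (measurableTypeR R))
    (q : 'I_L -> nat -> R) :
  (forall l i, measurable (A l i)) ->
  (forall l i, (i < D)%N ->
    lebesgue_measure (A l i `&` `[0%R, 1%R]%classic) = (q l i)%:E) ->
  cube_int D (fun g => (\sum_l a l * \prod_(i < D) \1_(A l i) (g i))%:E) =
  (\sum_l a l * \prod_(i < D) q l i)%:E.
Proof.
move=> mA; elim: D a => [|D IH] a qA /=.
  by congr EFin; apply: eq_bigr => l _; rewrite !big_ord0.
under eq_integral => t _.
  (* For fixed [t] the indicator of the top coordinate joins the coefficients, over which the
     induction hypothesis is general. *)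
  rewrite (_ : (fun g => _) = (fun g => (\sum_l (a l * \1_(A l D) t) *
      \prod_(i < D) \1_(A l i) (g i))%:E)); last first.
    apply/funext => g; congr EFin; apply: eq_bigr => l _.
    rewrite big_ord_recr /= eqxx -mulrA [X in _ = a l * X]mulrC; congr (_ * (_ * _)).
    by apply: eq_bigr => i _; rewrite ltn_eqF.
  rewrite IH; last by move=> l i iD; apply: qA; exact: leqW.
  over.
transitivity (\int[@lebesgue_measure R]_(t in `[0%R, 1%R]%classic)
   \sum_l ((a l * \prod_(i < D) q l i)%:E * (\1_(A l D) t)%:E))%E.
  apply: eq_integral => t _; rewrite -sumEFin; apply: eq_bigr => l _.
  by rewrite -EFinM; congr EFin; ring.
have intE l : (\int[@lebesgue_measure R]_(t in `[0%R, 1%R]%classic)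
    (\1_(A l D) t)%:E)%E = (q l D)%:E.
  by etransitivity; [apply: integral_indic|apply: qA].
have intA l : (@lebesgue_measure R).-integrable `[0%R, 1%R]%classic
    (fun t => (\1_(A l D) t)%:E).
  apply/integrableP; split; first by apply/measurable_EFinP; exact: measurable_indic.
  rewrite (@eq_integral _ (measurableTypeR R) R lebesgue_measure _ (fun t => (\1_(A l D) t)%:E)); last first.
    by move=> t _; rewrite gee0_abs// lee_fin.
  by rewrite intE ltry.
rewrite integral_sum//=; last first.
  by move=> l; apply: integrableZl.
rewrite -sumEFin; apply: eq_bigr => l _.
rewrite integralZl// intE -EFinM big_ord_recr/= mulrA.
by [].
Qed.

End CubeIntegral.

(** * Comparison of the torus norms, and arcs of the circle *)

Section TorusGeometry.
Context {R : realType}.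
Implicit Types (a b c t rho : R) (x y z : nat -> R) (d : nat) (pn : option nat).

Lemma circ_dist_ge0 a b : 0 <= a <= 1 -> 0 <= b <= 1 -> 0 <= circ_dist a b.
Proof.
move=> a01 b01; rewrite /circ_dist le_min normr_ge0 /= subr_ge0.
by rewrite ler_norml; lra.
Qed.

Lemma circ_dist_le1 a b : circ_dist a b <= 1.
Proof.
rewrite /circ_dist ge_min lerBlDr; apply/orP; right.
by rewrite lerDl.
Qed.

Lemma torus_dist_ext d pn z x y : (forall i, (i < d)%N -> x i = y i) ->
  torus_dist d pn z x = torus_dist d pn z y.
Proof.
move=> xy; rewrite /torus_dist; case: pn => [p|].
  by congr powR; apply: eq_bigr => i _; rewrite xy.
by apply: eq_bigr => i _; rewrite xy.
Qed.

Lemma powR_rootK (p : nat) a : (0 < p)%N -> 0 <= a -> powR (a ^+ p) p%:R^-1 = a.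
Proof.
move=> p0 a0; rewrite -powR_mulrn// -powRrM mulfV ?powRr1//.
by rewrite pnatr_eq0 -lt0n.
Qed.

Lemma circ_le_torus_dist d pn z x i : (forall p, pn = Some p -> (0 < p)%N) ->
  in_cube z -> in_cube x -> (i < d)%N ->
  circ_dist (z i) (x i) <= torus_dist d pn z x.
Proof.
move=> pn0 zc xc id_.
have c0 j : 0 <= circ_dist (z j) (x j) by apply: circ_dist_ge0.
rewrite /torus_dist; case: pn pn0 => [p|] pn0; last first.
  exact: (le_bigmax_cond _ (fun j : 'I_d => circ_dist (z j) (x j))
    (erefl : xpredT (Ordinal id_))).
have {pn0} p0 : (0 < p)%N by exact: pn0.
rewrite -[leLHS](powR_rootK p0)//.
apply: ge0_ler_powR; rewrite ?invr_ge0 ?ler0n ?nnegrE ?exprn_ge0//.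
  by apply: sumr_ge0 => j _; exact: exprn_ge0.
rewrite (bigD1 (Ordinal id_)) //= lerDl.
by apply: sumr_ge0 => j _; exact: exprn_ge0.
Qed.

(** With [circ_le_torus_dist] this compares each norm with the max-norm. The factor [d] is crude for
    finite [p], where [d ^ (1 / p)] would do, but it serves all norms at once. *)
Lemma torus_dist_le d pn z x b : (0 < d)%N ->
  (forall p, pn = Some p -> (0 < p)%N) -> in_cube z -> in_cube x -> 0 <= b ->
  (forall i, (i < d)%N -> circ_dist (z i) (x i) <= b) ->
  torus_dist d pn z x <= d%:R * b.
Proof.
move=> d0 pn0 zc xc b0 le_b.
have c0 j : 0 <= circ_dist (z j) (x j) by apply: circ_dist_ge0.
have d1 : 1 <= d%:R :> R by rewrite ler1n.
have bdb : b <= d%:R * b by rewrite ler_peMl.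
have db0 : 0 <= d%:R * b by exact: le_trans bdb.
rewrite /torus_dist; case: pn pn0 => [p|] pn0; last first.
  apply: bigmax_le => // i _; exact: le_trans (le_b _ _) bdb.
have {pn0} p0 : (0 < p)%N by exact: pn0.
rewrite -[leRHS](powR_rootK p0)//.
apply: ge0_ler_powR; rewrite ?invr_ge0 ?ler0n ?nnegrE ?exprn_ge0//.
  by apply: sumr_ge0 => j _; exact: exprn_ge0.
apply: (@le_trans _ _ (\sum_(i < d) b ^+ p)).
  by apply: ler_sum => i _; rewrite lerXn2r ?nnegrE// le_b.
rewrite sumr_const card_ord exprMn -[leLHS]mulr_natl ler_wpM2r ?exprn_ge0//.
by rewrite -{1}(expr1 d%:R) ler_weXn2l.
Qed.

(** A superset of the circular ball around [c]: the two intervals at the ends of [[0, 1]] catch the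
    wraparound wherever [c] lies. The lengths add up to [4 * rho]. *)
Definition near_arc c rho : set R :=
  (`[c - rho, c + rho] `|` `[0, rho] `|` `[1 - rho, 1])%classic.

Lemma mem_near_arc c t rho : 0 <= c <= 1 -> 0 <= t <= 1 ->
  circ_dist c t <= rho -> near_arc c rho t.
Proof.
move=> c01 t01; rewrite /circ_dist /near_arc /= !in_itv /= ge_min.
move=> /orP[|]; first by rewrite ler_norml => ?; left; left; lra.
rewrite lerBlDr -lerBlDl ler_normr => /orP[?|?]; [left; right|right]; lra.
Qed.

Lemma measurable_near_arc c rho :
  measurable (near_arc c rho : set (measurableTypeR R)).
Proof. by apply: measurableU => //; exact: measurableU. Qed.

Lemma near_arc_measure c rho : 0 <= rho ->
  exists q, [/\ lebesgue_measure (near_arc c rho `&` `[0%R, 1%R]%classic) = q%:E,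
    0 <= q & q <= 4 * rho].
Proof.
move=> rho0.
have mA := measurable_near_arc c rho.
have mI : measurable (`[0%R, 1%R]%classic : set (measurableTypeR R)) by [].
have len_le a b : a <= b -> (@lebesgue_measure R `[a, b]%classic <= (b - a)%:E)%E.
  move=> ab; rewrite lebesgue_measure_itv /= lte_fin -EFinB.
  by case: ifP => // _; rewrite lee_fin subr_ge0.
set m := lebesgue_measure _.
have m_le : (m <= (4 * rho)%:E)%E.
  apply: (@le_trans _ _ (lebesgue_measure (near_arc c rho : set (measurableTypeR R)))).
    by apply: le_measure; rewrite ?inE//; exact: measurableI.
  rewrite /near_arc.
  apply: le_trans (measureU2 _ _ _) _ => //; first exact: measurableU.
  apply: le_trans (leeD (measureU2 _ _ _) (lexx _)) _ => //.
  apply: le_trans (leeD (leeD (len_le _ _ _) (len_le _ _ _)) (len_le _ _ _)) _;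
    [lra..|].
  by rewrite -!EFinD lee_fin; lra.
have m_ge0 : (0 <= m)%E by exact: measure_ge0.
exists (fine m).
have mfin : m \is a fin_num by rewrite ge0_fin_numE// (le_lt_trans m_le)// ltry.
split; [by rewrite fineK|exact: fine_ge0|].
by rewrite -lee_fin fineK.
Qed.

(** Only the side of [c] with more room in [[0, 1]] is kept, so that for [rho <= 1 / 4] no
    wraparound occurs and the length is exactly [rho]. *)
Definition arc_shell c rho : set R :=
  if c <= 1 / 2 then `[c + rho, c + 2 * rho]%classic
  else `[c - 2 * rho, c - rho]%classic.

Lemma arc_shell_circ_dist c t rho : 0 <= c <= 1 -> 0 <= rho <= 1 / 4 ->
  arc_shell c rho t -> rho <= circ_dist c t <= 2 * rho.
Proof.
move=> c01 rho4; rewrite /arc_shell /circ_dist; case: leP => c2 /=;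
  rewrite in_itv /= => tI.
- rewrite ler0_norm ?le_min ?ge_min; last lra.
  by apply/andP; split; [apply/andP; split; lra|apply/orP; left; lra].
- rewrite ger0_norm ?le_min ?ge_min; last lra.
  by apply/andP; split; [apply/andP; split; lra|apply/orP; left; lra].
Qed.

Lemma measurable_arc_shell c rho :
  measurable (arc_shell c rho : set (measurableTypeR R)).
Proof. by rewrite /arc_shell; case: ifP. Qed.

Lemma arc_shell_measure c rho : 0 <= c <= 1 -> 0 <= rho <= 1 / 4 ->
  lebesgue_measure (arc_shell c rho `&` `[0%R, 1%R]%classic) = rho%:E.
Proof.
move=> c01 rho4.
have -> : arc_shell c rho `&` `[0%R, 1%R]%classic = arc_shell c rho.
  apply/setIidPl; rewrite /arc_shell; case: leP => c2 t /=; rewrite !in_itv /=;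
    lra.
have [->|rhoN0] := eqVneq rho 0.
  by rewrite /arc_shell mulr0 addr0 subr0; case: ifP => _;
     rewrite set_itv1 lebesgue_measure_set1.
have rho0 : 0 < rho by lra.
rewrite /arc_shell; case: ifP => _; rewrite lebesgue_measure_itv /= lte_fin.
  by rewrite ltrD2l ifT; [rewrite -EFinB; congr EFin; ring|lra].
by rewrite ifT; [rewrite -EFinB; congr EFin; ring|lra].
Qed.

End TorusGeometry.

(** * Integrals over the position of a single variable *)

Section BlockIntegrals.
Context {R : realType}.
Variables (d : nat) (pn : option nat).
Hypothesis pn_gt0 : forall p, pn = Some p -> (0 < p)%N.
Implicit Types (x z : nat -> R) (rho r e b : R).

(** The lower bound is imposed on every coordinate, not just on the largest: this makes the event
    contain a product of arcs. *)
Definition in_shell rho z x : bool :=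
  [forall i : 'I_d, rho <= circ_dist (z i) (x i) <= 2 * rho].

Definition in_ball rho z x : bool :=
  [forall i : 'I_d, circ_dist (z i) (x i) <= rho].

Lemma in_shell_ext rho z x y : (forall i, (i < d)%N -> x i = y i) ->
  in_shell rho z x = in_shell rho z y.
Proof. by move=> xy; apply: eq_forallb => i; rewrite xy. Qed.

Lemma in_ball_ext rho z x y : (forall i, (i < d)%N -> x i = y i) ->
  in_ball rho z x = in_ball rho z y.
Proof. by move=> xy; apply: eq_forallb => i; rewrite xy. Qed.

Lemma prodr_indic (A : nat -> set R) x :
  \prod_(i < d) \1_(A i) (x i) = [forall i : 'I_d, x i \in A i]%:R :> R.
Proof.
case: (boolP [forall i : 'I_d, x i \in A i]) => [/forallP h|].
  by apply: big1 => i _; rewrite indicE h.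
rewrite negb_forall => /existsP[i hi].
by rewrite (bigD1 i)//= indicE (negbTE hi) mul0r.
Qed.

Lemma shell_integral rho z : in_cube z -> 0 <= rho <= 1 / 4 ->
  ((rho ^+ d)%:E <= cube_int d (fun x => (in_shell rho z x)%:R%:E))%E.
Proof.
move=> zc rho4.
have := @cube_int_lincomb_indic R d 1 (fun=> 1) (fun _ i => arc_shell (z i) rho)
  (fun _ _ => rho) (fun _ _ => measurable_arc_shell _ _)
  (fun _ i _ => arc_shell_measure (zc i) rho4).
rewrite big_ord1 mul1r prodr_const card_ord => <-.
apply: le_cube_int => x xc; rewrite lee_fin big_ord1 mul1r.
rewrite (prodr_indic (fun i => arc_shell (z i) rho)) ler_nat.
case: (boolP [forall i : 'I_d, _ \in _]) => // /forallP xin.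
suff -> : in_shell rho z x by [].
apply/forallP => i; apply: arc_shell_circ_dist => //.
by have := xin i; rewrite inE.
Qed.

Lemma powR_exprn (a e : R) n : 0 <= a -> powR (a ^+ n) e = powR a e ^+ n.
Proof.
move=> a0; elim: n => [|n IH]; first by rewrite !expr0 powR1.
by rewrite !exprS powRM ?exprn_ge0// IH.
Qed.

Lemma powR_invr (a e : R) : 0 <= a -> powR a^-1 e = (powR a e)^-1.
Proof. by move=> a0; rewrite -powR_inv1// powRAC powR_inv1// powR_ge0. Qed.

Lemma geometric_sum_le (q : R) L : 0 <= q < 1 -> \sum_(l < L) q ^+ l <= (1 - q)^-1.
Proof.
move=> /andP[q0 q1]; have q1' : 0 < 1 - q by rewrite subr_gt0.
rewrite -[leRHS]mul1r ler_pdivlMr// mulrC.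
have -> : (1 - q) * \sum_(l < L) q ^+ l = 1 - q ^+ L.
  by rewrite -[LHS]opprK -mulNr opprB -subrX1 opprB.
by rewrite gerBl exprn_ge0.
Qed.

(* [far_weight b e r z x] is what a variable of radius [r] at [x] contributes
   when it is not drawn by the clause at [z]. *)
Definition far_weight b e r z x : R :=
  (~~ in_ball (b * r) z x)%:R * expR (- powR (r / torus_dist d pn z x) e).

Lemma far_weight_ge0 b e r z x : 0 <= far_weight b e r z x.
Proof. by rewrite mulr_ge0// expR_ge0. Qed.

Lemma far_weight_ext b e r z x y : (forall i, (i < d)%N -> x i = y i) ->
  far_weight b e r z x = far_weight b e r z y.
Proof.
move=> xy; rewrite /far_weight (in_ball_ext _ _ xy).
by rewrite (torus_dist_ext _ _ xy).
Qed.

(** Let [l] be the least index whose ball contains [x]; the ball of index [L] is the whole torus. If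
    [l = 0], the left side is at most 0 since [powR 2 e >= 1]. Otherwise the distance exceeds
    [2 ^ (l - 1) * b * r], and [exp (- y) >= 1 - y] applies. All other terms of the sum only
    help. *)
Lemma far_weight_dyadic b e r z x L : 0 < e -> 1 <= b -> 0 < r ->
  1 <= 2 ^+ L * (b * r) -> in_cube z -> in_cube x ->
  1 - \sum_(l < L.+1) powR 2 e * (powR 2 e)^-1 ^+ l * (in_ball (2 ^+ l * (b * r)) z x)%:R
    <= far_weight b e r z x.
Proof.
move=> e0 b1 r0 hL zc xc.
have C1 : 1 <= powR 2 e :> R 
  by rewrite -[leLHS](powRr0 2); apply: ler_powR; rewrite ?ler1n ?ltW.
have C0 : 0 < powR 2 e :> R by exact: lt_le_trans _ C1.
pose P l := in_ball (2 ^+ l * (b * r)) z x.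
have PL : P L.
  by apply/forallP => i; exact: le_trans (circ_dist_le1 _ _) hL.
have [l Pl lmin] := ex_minnP (ex_intro P L PL).
have lL : (l < L.+1)%N by rewrite ltnS lmin.
rewrite (bigD1 (Ordinal lL))//= -/(P l) Pl mulr1 opprD addrA lerBlDr.
apply: (@le_trans _ _ (far_weight b e r z x)); last first.
  rewrite lerDl; apply: sumr_ge0 => m _.
  by rewrite !mulr_ge0 ?exprn_ge0 ?invr_ge0 ?powR_ge0.
case: l Pl lmin {lL} => [|l] Pl lmin.
  apply: le_trans _ (far_weight_ge0 b e r z x).
  by rewrite expr0 mulr1 subr_le0.
have nPl : ~~ P l by apply/negP => /lmin; rewrite ltnn.
have nP0 : ~~ P 0%N by apply/negP => /lmin; rewrite ltn0.
move: nP0; rewrite /P expr0 mul1r => nP0.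
rewrite /far_weight nP0 mul1r exprS mulVKf ?gt_eqF//.
apply: le_trans _ (expR_ge1Dx _); rewrite lerD2l lerN2.
move: nPl; rewrite negb_forall => /existsP[i]; rewrite -ltNge => far_i.
have := lt_le_trans far_i (circ_le_torus_dist pn_gt0 zc xc (ltn_ord i)).
set D := torus_dist _ _ _ _ => far.
have l2 : 0 < 2 ^+ l :> R by rewrite exprn_gt0.
have D0 : 0 < D by apply: le_lt_trans _ far; rewrite !mulr_ge0// ltW// (lt_le_trans _ b1).
rewrite exprVn -powR_exprn// -powR_invr ?(ltW l2)//.
apply: ge0_ler_powR; rewrite ?nnegrE ?divr_ge0 ?invr_ge0 ?(ltW e0) ?(ltW r0)
  ?(ltW D0) ?(ltW l2)//.
rewrite ler_pdivrMr// -ler_pdivrMl ?invr_gt0// invrK ltW//.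
apply: le_lt_trans _ far; rewrite ler_pM2l//.
by rewrite ler_peMl// ltW.
Qed.

(** The dyadic series summed: the ball of index [l] has volume at most [(4 * 2 ^ l * b * r) ^ d] and
    coefficient [2 ^ e * 2 ^ (- e * l)], so the ratio is [2 ^ d / 2 ^ e]. The factor [r ^ d] is left
    out. *)
Definition far_const b e : R :=
  powR 2 e * (4 * b) ^+ d / (1 - 2 ^+ d / powR 2 e).

Lemma dyadic_ratio_lt1 e : d%:R < e -> 0 <= (2 ^+ d / powR 2 e : R) < 1.
Proof.
move=> de; rewrite divr_ge0 ?exprn_ge0 ?powR_ge0//= ltr_pdivrMr ?powR_gt0//.
rewrite mul1r -powR_mulrn// /powR gt_eqF// ltr_expR ltr_pM2r// ln_gt0//.
by rewrite ltr1n.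
Qed.

Lemma far_const_ge0 b e : 0 <= b -> d%:R < e -> 0 <= far_const b e.
Proof.
move=> b0 /dyadic_ratio_lt1/andP[_ q1].
by rewrite divr_ge0 ?subr_ge0 ?(ltW q1)// mulr_ge0 ?powR_ge0 ?exprn_ge0 ?mulr_ge0.
Qed.

Lemma far_weight_integral b e r z : 1 <= b -> d%:R < e -> 0 < r -> in_cube z ->
  ((1 - far_const b e * r ^+ d)%:E <=
     cube_int d (fun x => (far_weight b e r z x)%:E))%E.
Proof.
move=> b1 de r0 zc.
have e0 : 0 < e by exact: le_lt_trans _ de.
have b0 : 0 < b by exact: lt_le_trans _ b1.
have br0 : 0 < b * r by rewrite mulr_gt0.
have C0 : 0 < powR 2 e :> R by exact: powR_gt0.
have q01 := dyadic_ratio_lt1 de.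
have [L hL] : exists L, 1 <= 2 ^+ L * (b * r).
  exists (Num.truncn (b * r)^-1).+1; rewrite -ler_pdivrMr// div1r.
  apply: ltW; apply: lt_le_trans (truncnS_gt _) _.
  by rewrite -natrX ler_nat ltnW// ltn_expl.
pose rad l : R := 2 ^+ l * (b * r).
have rad0 l : 0 <= rad l by rewrite mulr_ge0// ?exprn_ge0// ltW.
have /choice[q qP] : forall li : nat * nat, exists q,
    [/\ lebesgue_measure (near_arc (z li.2) (rad li.1) `&` `[0%R, 1%R]%classic) = q%:E,
      0 <= q & q <= 4 * rad li.1].
  by move=> li; exact: near_arc_measure.
(* Index 0 carries the constant 1, and index [l.+1] the dyadic ball of index [l]. *)
pose A (l : 'I_L.+2) (i : nat) : set (measurableTypeR R) :=
  if l == ord0 then setT else near_arc (z i) (rad l.-1).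
pose a (l : 'I_L.+2) : R :=
  if l == ord0 then 1 else - (powR 2 e * (powR 2 e)^-1 ^+ l.-1).
pose Q (l : 'I_L.+2) (i : nat) : R := if l == ord0 then 1 else q (l.-1, i).
have mA l i : measurable (A l i).
  by rewrite /A; case: ifP => // _; exact: measurable_near_arc.
have QA l i : (i < d)%N ->
    lebesgue_measure (A l i `&` `[0%R, 1%R]%classic) = (Q l i)%:E.
  move=> _; rewrite /A /Q; case: ifP => _.
    by rewrite setTI; exact: lebesgue_measure_unit_itv.
  by have [] := qP (l.-1, i).
have intE := cube_int_lincomb_indic a mA QA.
apply: (@le_trans _ _ (cube_int d
  (fun x => (\sum_l a l * \prod_(i < d) \1_(A l i) (x i))%:E))).
  rewrite intE lee_fin big_ord_recl {1}/a eqxx mul1r {1}/Q big1//.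
  rewrite lerD2l lerNl -sumrN.
  apply: (@le_trans _ _ (\sum_(l < L.+1)
     (powR 2 e * (4 * b * r) ^+ d) * (2 ^+ d / powR 2 e) ^+ l)).
    apply: ler_sum => l _; rewrite /a /Q /= mulNr opprK.
    have -> : powR 2 e * (4 * b * r) ^+ d * (2 ^+ d / powR 2 e) ^+ l =
        powR 2 e * (powR 2 e)^-1 ^+ l * \prod_(i < d) (4 * rad l).
      have radE : 4 * rad l = 4 * b * r * 2 ^+ l by rewrite /rad; ring.
      rewrite prodr_const card_ord radE (exprMn l (2 ^+ d)) [in RHS]exprMn -!exprM [(l * d)%N]mulnC.
      by move: ((4 * b * r) ^+ d) (2 ^+ _) (_^-1 ^+ _) => *; ring.
    rewrite ler_wpM2l ?mulr_ge0 ?exprn_ge0 ?invr_ge0 ?powR_ge0//.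
    by apply: ler_prod => i _; have [_ -> ->] := qP ((lift ord0 l).-1, i : nat).
  rewrite -mulr_sumr /far_const [leRHS]mulrAC -[_ * r ^+ d]mulrA -exprMn.
  rewrite ler_wpM2l//; last exact: geometric_sum_le.
  by rewrite mulr_ge0 ?powR_ge0// exprn_ge0// !mulr_ge0// ltW.
apply: le_cube_int => x xc; rewrite lee_fin.
apply: le_trans _ (far_weight_dyadic e0 b1 r0 hL zc xc).
rewrite big_ord_recl {1}/a eqxx mul1r {1}/A big1 ?lerD2l; last first.
  by move=> i _; rewrite indicT.
(* The coefficients are negative, so enlarging each ball to a product of arcs only lowers the
   minorant. *)
rewrite -sumrN; apply: ler_sum => l _; rewrite /a /= mulNr lerN2.
rewrite ler_wpM2l ?mulr_ge0 ?exprn_ge0 ?invr_ge0 ?powR_ge0//.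
rewrite /A /= (prodr_indic (fun i => near_arc (z i) (rad l))) ler_nat.
case: (boolP (in_ball _ _ _)) => // /forallP inb.
suff -> : [forall i : 'I_d, x i \in near_arc (z i) (rad l)] by [].
apply/forallP => i; rewrite inE; apply: mem_near_arc => //; exact: inb.
Qed.

End BlockIntegrals.

(** * Drawing without repetition, for fixed connection weights *)

Section Draws.
Context {R : realType} {n k : nat}.
Implicit Types (X Y p : 'I_n -> R) (u : {ffun 'I_k -> 'I_n}).

Lemma draw_prob_ge0 X u : (forall v, 0 <= X v) -> 0 <= draw_prob X u.
Proof.
by move=> X0; apply: prodr_ge0 => j _; rewrite divr_ge0// sumr_ge0.
Qed.

Lemma remaining_self u (j : 'I_k) : injective u ->
  [forall j' : 'I_k, (j' < j)%N ==> (u j != u j')].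
Proof.
move=> uI; apply/forallP => j'; apply/implyP => j'j; apply/eqP => /uI jj'.
by rewrite jj' ltnn in j'j.
Qed.

Lemma draw_prob_le1 X u : injective u -> (forall v, 0 <= X v) ->
  draw_prob X u <= 1.
Proof.
move=> uI X0; apply: prodr_ile1 => j _.
rewrite divr_ge0 ?sumr_ge0//=; set S := \sum_(v < n | _) _.
have XS : X (u j) <= S.
  by rewrite /S (bigD1 (u j)) ?remaining_self//= lerDl sumr_ge0.
have [S0|S0] := leP S 0; last by rewrite ler_pdivrMr// mul1r.
have -> : X (u j) = 0 by apply/eqP; rewrite eq_le X0 andbT (le_trans XS).
by rewrite mul0r ler01.
Qed.

(** At the first index where the sequences differ, each entry is still a candidate in the other
    sequence, so each would have strictly larger weight. Hence at most one term enters the sum of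
    nice draws. *)
Lemma nice_seq_uniq X u u' : injective u -> injective u' ->
  nice_seq X u -> nice_seq X u' -> u = u'.
Proof.
move=> uI u'I nu nu'; apply/ffunP => j.
have [m] := ubnP j; elim: m j => // m IH j; rewrite ltnS => jm.
have {}IH (i : 'I_k) : (i < j)%N -> u i = u' i.
  by move=> ij; apply: IH; exact: leq_trans ij jm.
apply/eqP/negP => /negP neq.
have le_notin (a b : {ffun 'I_k -> 'I_n}) : injective a -> (a j != b j) ->
    (forall i : 'I_k, (i < j)%N -> a i = b i) ->
    [forall j' : 'I_k, (j' <= j)%N ==> (a j != b j')].
  move=> aI ab eqab; apply/forallP => i; apply/implyP; rewrite leq_eqVlt.
  move=> /predU1P[/val_inj -> //|ij]; rewrite -eqab//; apply/eqP => /aI ji.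
  by rewrite ji ltnn in ij.
have /forallP/(_ j)/forallP/(_ (u' j))/implyP lt1 := nu.
have /forallP/(_ j)/forallP/(_ (u j))/implyP lt2 := nu'.
have {}lt1 : X (u' j) < X (u j).
  by apply: lt1; apply: le_notin => //; [rewrite eq_sym|move=> i /IH].
have {}lt2 : X (u j) < X (u' j) by apply: lt2; exact: le_notin.
by have := lt_trans lt1 lt2; rewrite ltxx.
Qed.

Lemma nice_draws_le1 X : (forall v, 0 <= X v) ->
  0 <= \sum_(u : {ffun 'I_k -> 'I_n} | injectiveb u && nice_seq X u)
         draw_prob X u <= 1.
Proof.
move=> X0; apply/andP; split; first by apply: sumr_ge0 => u _; exact: draw_prob_ge0.
case: (pickP [pred u : {ffun 'I_k -> 'I_n} | injectiveb u && nice_seq X u])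
  => [u0 /= u0P|none]; last first.
  by rewrite big_pred0// ler01.
rewrite (bigD1 u0)//= big_pred0 ?addr0.
  by case/andP: u0P => /injectiveP u0I _; exact: draw_prob_le1.
move=> u; apply/negP => /andP[/andP[/injectiveP uI nu]]; apply/negP; rewrite negbK.
by case/andP: u0P => /injectiveP u0I nu0; apply/eqP/(nice_seq_uniq uI u0I nu nu0).
Qed.

Lemma big_codom_inj (T : Type) (idx : T) (op : Monoid.com_law idx)
    u (F : 'I_n -> T) : injective u ->
  \big[op/idx]_(v < n | v \in codom u) F v = \big[op/idx]_(j < k) F (u j).
Proof.
move=> uI; rewrite (eq_bigl (mem (u @: [set: 'I_k]%SET))); last first.
  by move=> v; apply/codomP/imsetP => [[j ->]|[j _ ->]]; exists j.
rewrite big_imset/=; last by move=> ? ? _ _; exact: uI.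
by apply: eq_bigl => j; rewrite inE.
Qed.

(* The rest of the weight enters each factor through [1 / (1 + S / k)], which is at
   least [expR (- S / k)]; this makes the bound a product over the variables. *)
Lemma draw_prob_ge X Y u (s alpha : R) : (0 < k)%N -> injective u -> 0 < s ->
  (forall v, X v = s * Y v) -> (forall v, 0 <= Y v) -> 0 < alpha ->
  (forall j, alpha <= Y (u j) <= 1) ->
  (alpha / k%:R) ^+ k * \prod_(v < n | v \notin codom u) expR (- Y v) <=
    draw_prob X u.
Proof.
move=> k0 uI s0 XY Y0 alpha0 Yu.
have kR0 : 0 < k%:R :> R by rewrite ltr0n.
pose S := \sum_(v < n | v \notin codom u) Y v.
have S0 : 0 <= S by exact: sumr_ge0.
rewrite -expR_sum sumrN -/S.
have -> : (alpha / k%:R) ^+ k * expR (- S) =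
    \prod_(j < k) (alpha / k%:R * expR (- (S / k%:R))).
  rewrite prodr_const card_ord [in RHS]exprMn -expRM_natl; congr (_ * expR _).
  by rewrite mulrN mulrCA mulfV ?mulr1// gt_eqF.
apply: ler_prod => j _; apply/andP; split.
  by rewrite mulr_ge0 ?expR_ge0// divr_ge0 ?ltW.
have /andP[aY _] := Yu j.
have Xj0 : 0 < X (u j) by rewrite XY mulr_gt0// (lt_le_trans alpha0).
set Dn := \sum_(v < n | _) _.
have Dn0 : 0 < Dn.
  rewrite /Dn (bigD1 (u j)) ?remaining_self//= ltr_wpDr//.
  by rewrite sumr_ge0// => v _; rewrite XY mulr_ge0// ltW.
(* Each of the [k] drawn variables contributes at most [s], since [Y (u j) <= 1]. *)
have DnS : Dn <= s * (k%:R + S).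
  apply: (@le_trans _ _ (\sum_(v < n) X v)).
    rewrite /Dn [leRHS](bigID (fun v => [forall j' : 'I_k, (j' < j)%N ==> (v != u j')]))/=.
    by rewrite lerDl sumr_ge0// => v _; rewrite XY mulr_ge0// ltW.
  under eq_bigr do rewrite XY; rewrite -mulr_sumr ler_pM2l//.
  rewrite (bigID (fun v => v \in codom u))/= lerD2r big_codom_inj//.
  rewrite -[X in _ <= X%:R](card_ord k) -sumr_const; apply: ler_sum => i _.
  by have /andP[] := Yu i.
have kS : k%:R + S <= k%:R * expR (S / k%:R).
  rewrite -ler_pdivrMl// mulrDr mulVf ?gt_eqF// [_ * S]mulrC.
  exact: expR_ge1Dx.
rewrite ler_pdivlMr//.
apply: (@le_trans _ _ (alpha / k%:R * expR (- (S / k%:R)) *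
    (s * (k%:R * expR (S / k%:R))))).
  rewrite ler_wpM2l//; last by rewrite (le_trans DnS)// ler_pM2l.
  by rewrite mulr_ge0 ?expR_ge0// divr_ge0 ?ltW.
have -> : alpha / k%:R * expR (- (S / k%:R)) * (s * (k%:R * expR (S / k%:R))) =
    s * alpha.
  rewrite expRN; field; rewrite gt_eqF ?expR_gt0//=.
  by rewrite gt_eqF.
by rewrite XY ler_pM2l.
Qed.

(** Read [p] as a distribution: [k] independent samples collide with probability at most
    [k * k * eps], by a union bound over pairs of indices. *)
Lemma sum_injections_ge p eps : (forall v, 0 <= p v <= eps) ->
  \sum_v p v = 1 ->
  1 - (k * k)%:R * eps <=
    \sum_(u : {ffun 'I_k -> 'I_n} | injectiveb u) \prod_(j < k) p (u j).
Proof.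
move=> p0eps p1.
have p0 v : 0 <= p v by have /andP[] := p0eps v.
pose w (u : {ffun 'I_k -> 'I_n}) := \prod_(j < k) p (u j).
have w0 u : 0 <= w u by exact: prodr_ge0.
have tot : \sum_(u : {ffun 'I_k -> 'I_n}) w u = 1.
  by rewrite /w -(bigA_distr_bigA (fun _ v => p v)) big1.
have coll (i j : 'I_k) : i != j -> \sum_(u : {ffun 'I_k -> 'I_n} | u i == u j) w u <= eps.
  move=> ij.
  have -> : \sum_(u : {ffun 'I_k -> 'I_n} | u i == u j) w u = \sum_a p a * p a.
    rewrite (partition_big (fun u : {ffun 'I_k -> 'I_n} => u i) xpredT)//=.
    apply: eq_bigr => a _.
    (* [F] pins the samples [i] and [j] to the value [a], so that the collision sum factorises over
       the indices. *)
    pose F (l : 'I_k) v := if (l == i) || (l == j) then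
       (if v == a then p v else 0) else p v.
    transitivity (\sum_(u : {ffun 'I_k -> 'I_n}) \prod_l F l (u l)).
      rewrite [RHS](bigID (fun u : {ffun 'I_k -> 'I_n} => (u i == u j) && (u i == a)))/=.
      rewrite [X in _ = _ + X]big1 ?addr0; last first.
        move=> u; rewrite negb_and => nu.
        have [uia|uia] := eqVneq (u i) a; last first.
          by rewrite (bigD1 i)//= /F eqxx /= (negbTE uia) mul0r.
        rewrite (bigD1 j)//= /F eqxx orbT.
        have -> : (u j == a) = false; last by rewrite mul0r.
        by move: nu; rewrite uia eqxx orbF eq_sym => /negbTE.
      apply: eq_bigr => u /andP[/eqP uij /eqP uia]; apply: eq_bigr => l _.
      rewrite /F; case: ifP => // /orP[]/eqP ->; first by rewrite uia eqxx.
      by rewrite -uij uia eqxx.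
    rewrite -(bigA_distr_bigA F) (bigD1 i)//= (bigD1 j)/=; last by rewrite eq_sym.
    rewrite [X in _ * (_ * X)]big1 ?mulr1; last first.
      by move=> l /andP[/negbTE li /negbTE lj]; rewrite /F li lj.
    have Fa l : (l == i) || (l == j) -> \sum_v F l v = p a.
      by move=> lij; rewrite /F lij -big_mkcond big_pred1_eq.
    by rewrite !Fa ?eqxx ?orbT.
  apply: (@le_trans _ _ (\sum_a eps * p a)); last by rewrite -mulr_sumr p1 mulr1.
  by apply: ler_sum => a _; rewrite ler_wpM2r//; have /andP[] := p0eps a.
have bad : \sum_(u : {ffun 'I_k -> 'I_n} | ~~ injectiveb u) w u <= (k * k)%:R * eps.
  apply: (@le_trans _ _ (\sum_(u : {ffun 'I_k -> 'I_n}) \sum_(ij : 'I_k * 'I_k | ij.1 != ij.2)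
      (if u ij.1 == u ij.2 then w u else 0))).
    rewrite big_mkcond; apply: ler_sum => u _; case: ifPn => nu; last first.
      by apply: sumr_ge0 => ij _; case: ifP.
    have /injectivePn[i [j ij uij]] := nu.
    rewrite (bigD1 (i, j))//= uij eqxx lerDl sumr_ge0// => ij' _.
    by case: ifP.
  rewrite exchange_big /=.
  apply: (@le_trans _ _ (\sum_(ij : 'I_k * 'I_k) eps)); last first.
    by rewrite sumr_const card_prod card_ord mulr_natl.
  rewrite big_mkcond /=; apply: ler_sum => -[i j] _ /=; case: ifPn => ij.
    by rewrite -big_mkcond; exact: coll.
  clear ij.
  (* The diagonal pairs need [0 <= eps], which follows from the existence of some [v], as [p] sums
     to 1. *)
  have [v pv] : exists v, 0 <= p v <= eps.
    case: (pickP (@predT 'I_n)) => [v _|none]; first by exists v.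
    by move: p1; rewrite big_pred0// => /eqP; rewrite eq_sym oner_eq0.
  lra.
rewrite lerBlDr -[leLHS]tot [leLHS](bigID (fun u : {ffun 'I_k -> 'I_n} => injectiveb u))/=.
by rewrite lerD2l.
Qed.

End Draws.

(** * The explicit constants, depending on [k], [d] and [T] only *)

Section Constants.
Context {R : realType}.
Variables (k d : nat) (T : R).

(* A point of the shell [rho, 2 rho] (in the max-norm) has [torus_dist] in
   [rho, 2 d rho], so the ratio [3 d] keeps the distances of successive shells
   disjoint. *)
Definition shell_scale (j : nat) : R := (3 * d%:R) ^+ j.
Definition decay_exponent : R := d%:R / T.
Definition far_mass : R := far_const d (shell_scale k) decay_exponent.
(** A lower bound for [Y] at each drawn variable, whose distance is at most [2 * d * (3 * d) ^ k]
    times its radius. *)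
Definition draw_ratio : R := powR (2 * d%:R * shell_scale k)^-1 decay_exponent.
(** The first factor comes from the draws, the exponential from the variables not drawn, and the
    half from the restriction to injective sequences. *)
Definition nice_const : R := (draw_ratio / k%:R) ^+ k * (expR (- (2 * far_mass)) / 2).

End Constants.

(** * The product minorant and its integral *)

Section NiceClause.
Context {R : realType}.
Variables (n k d : nat) (pn : option nat) (T : R) (w : 'I_n -> R) (eps : R).
Hypotheses (k_gt0 : (0 < k)%N) (d_gt0 : (0 < d)%N).
Hypothesis pn_gt0 : forall p, pn = Some p -> (0 < p)%N.
Hypotheses (T_gt0 : 0 < T) (T_lt1 : T < 1) (w_ge1 : forall v, 1 <= w v).
Hypotheses (n_gt0 : (0 < n)%N) (w_small : forall v, w v / (\sum_v w v) <= eps).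
(** The three smallness conditions serve, in order, to replace [1 - t] by [exp (- 2 * t)], to keep
    half of the mass on injective sequences, and to keep shell radii below [1 / 4]. *)
Hypothesis eps_far : 2 * far_mass k d T * eps <= 1.
Hypothesis eps_inj : 2 * (k * k)%:R * eps <= 1.
Hypothesis eps_shell : (4 * shell_scale d k) ^+ d * eps <= 1.

Local Notation shell_scale := (@shell_scale R d).
Let W := \sum_v w v.
Let e := decay_exponent d T.
Let b := shell_scale k.
Let A := far_mass k d T.

Let W_gt0 : 0 < W.
Proof.
apply: (@lt_le_trans _ _ (\sum_(v < n) 1)).
  by rewrite sumr_const card_ord ltr0n.
by apply: ler_sum.
Qed.

Let d_ge1 : 1 <= d%:R :> R. Proof. by rewrite ler1n. Qed.
Let d_pos : 0 < d%:R :> R. Proof. by rewrite ltr0n. Qed.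

Let shell_scale_gt0 j : 0 < shell_scale j.
Proof. by rewrite exprn_gt0// mulr_gt0. Qed.

Let b_gt0 : 0 < b. Proof. exact: shell_scale_gt0. Qed.

Let shell_scale_homo i j : (i <= j)%N -> shell_scale i <= shell_scale j.
Proof. by move=> ij; apply: ler_weXn2l => //; have := d_ge1; lra. Qed.

Let shell_scale_ge1 j : 1 <= shell_scale j.
Proof. by have := @shell_scale_homo 0 j (leq0n _); rewrite /shell_scale expr0. Qed.

Let p (v : 'I_n) := w v / W.
Let p_gt0 v : 0 < p v.
Proof. by rewrite divr_gt0// (lt_le_trans ltr01). Qed.

Let sum_p : \sum_v p v = 1.
Proof. by rewrite /p -mulr_suml -/W divff// gt_eqF. Qed.

Let p_le v : p v <= eps. Proof. exact: w_small. Qed.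

Definition var_radius (v : 'I_n) : R := powR (w v / \sum_v w v) d%:R^-1.
Local Notation r := var_radius.

Let r_gt0 v : 0 < r v. Proof. by apply: powR_gt0; exact: p_gt0. Qed.

Let r_exp v : r v ^+ d = p v.
Proof.
rewrite -powR_mulrn ?powR_ge0// -powRrM mulVf ?powRr1 ?(ltW (p_gt0 v))//.
by rewrite gt_eqF.
Qed.

Let e_gt_d : d%:R < e.
Proof. by rewrite /e /decay_exponent ltr_pdivlMr// gtr_pMr. Qed.

Let e_gt0 : 0 < e. Proof. by rewrite divr_gt0. Qed.

Let torus_dist_ge0 (z x : nat -> R) : 0 <= torus_dist d pn z x.
Proof.
rewrite /torus_dist; case: pn => [q|]; first exact: powR_ge0.
exact: bigmax_ge_id.
Qed.

Let Y (z : nat -> R) v (x : nat -> R) := powR (r v / torus_dist d pn z x) e.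

(** The factor [powR W T^-1] is common to all variables: it preserves the order and cancels in every
    draw. *)
Let conn_weightE z v x :
  conn_weight d pn T (w v) z x = powR W T^-1 * Y z v x.
Proof.
rewrite /conn_weight /Y; set D := torus_dist _ _ _ _.
have -> : w v / D ^+ d = W * (r v / D) ^+ d.
  by rewrite expr_div_n r_exp /p mulrA mulrCA divff ?mulr1 ?gt_eqF.
have rD : 0 <= r v / D by rewrite divr_ge0 ?(ltW (r_gt0 v))// torus_dist_ge0.
rewrite powRM ?(ltW W_gt0) ?exprn_ge0//; congr (_ * _).
by rewrite -powR_mulrn// -powRrM.
Qed.

(** Quantifying over all [j] with [u j = v] avoids choosing a preimage; for injective [u] there is
    just one. *)
Let H (z : nat -> R) (u : {ffun 'I_k -> 'I_n}) (v : 'I_n)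
    (x : nat -> R) : R :=
  if v \in codom u then
    [forall j, (u j == v) ==> in_shell d (shell_scale j * r v) z x]%:R
  else far_weight d pn b e (r v) z x.

Let H_ge0 z u v x : 0 <= H z u v x.
Proof. by rewrite /H; case: ifP => // _; exact: far_weight_ge0. Qed.

Let H_ext z u v x y : (forall i, (i < d)%N -> x i = y i) -> H z u v x = H z u v y.
Proof.
move=> xy; rewrite /H (far_weight_ext _ _ _ _ _ xy); case: ifP => // _.
have -> // : [forall j, (u j == v) ==> in_shell d (shell_scale j * r v) z x] =
    [forall j, (u j == v) ==> in_shell d (shell_scale j * r v) z y].
by apply: eq_forallb => j; rewrite (in_shell_ext _ _ xy).
Qed.

Let alpha : R := draw_ratio k d T.

Let alpha_gt0 : 0 < alpha.
Proof. by rewrite powR_gt0// invr_gt0 !mulr_gt0// b_gt0. Qed.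

Let c0 : R := (alpha / k%:R) ^+ k.

Let c0_gt0 : 0 < c0.
Proof. by rewrite exprn_gt0// divr_gt0// ltr0n. Qed.

Let X_ (z : nat -> R) (x : 'I_n -> nat -> R) v := conn_weight d pn T (w v) z (x v).

Let nice_draw_ge z (x : 'I_n -> nat -> R) (u : {ffun 'I_k -> 'I_n}) : in_cube z ->
  (forall v, in_cube (x v)) -> injective u ->
  c0 * \prod_v H z u v (x v) <=
    (if nice_seq (X_ z x) u then draw_prob (X_ z x) u else 0).
Proof.
move=> zc xc uI; set X := X_ z x.
have X_ge0 v : 0 <= X v by exact: powR_ge0.
have rhs_ge0 : 0 <= (if nice_seq X u then draw_prob X u else 0).
  by case: ifP => // _; exact: draw_prob_ge0.
(* If a factor vanishes the bound is trivial; if none does, every variable is in its prescribed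
   region. *)
case: (boolP [forall v, H z u v (x v) != 0]) => [/forallP Hne|]; last first.
  rewrite negb_forall => /existsP[v]; rewrite negbK => /eqP Hv.
  by rewrite (bigD1 v)//= Hv mul0r mulr0.
pose D v := torus_dist d pn z (x v).
have shells (j : 'I_k) : in_shell d (shell_scale j * r (u j)) z (x (u j)).
  have := Hne (u j); rewrite /H codom_f.
  case: (boolP [forall i, _ ==> _]) => [/forallP/(_ j)|]; last by rewrite eqxx.
  by rewrite eqxx.
have fars v : v \notin codom u -> ~~ in_ball d (b * r v) z (x v).
  move=> vu; have := Hne v; rewrite /H (negbTE vu) /far_weight.
  by case: in_ball => //; rewrite mul0r eqxx.
have Dlo (j : 'I_k) : shell_scale j * r (u j) <= D (u j).
  have /forallP/(_ (Ordinal d_gt0))/andP[lo _] := shells j.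
  by apply: le_trans lo _; exact: circ_le_torus_dist.
have Dhi (j : 'I_k) : D (u j) <= 2 * d%:R * shell_scale j * r (u j).
  have -> : 2 * d%:R * shell_scale j * r (u j) =
      d%:R * (2 * (shell_scale j * r (u j))) by ring.
  apply: torus_dist_le => //; first by rewrite !mulr_ge0 ?ltW.
  by move=> i id_; have /forallP/(_ (Ordinal id_))/andP[] := shells j.
have Dfar v : v \notin codom u -> b * r v <= D v.
  move=> /fars; rewrite negb_forall => /existsP[i]; rewrite -ltNge => /ltW h.
  by apply: le_trans h _; exact: circ_le_torus_dist.
have D_gt0 v : 0 < D v.
  have [/codomP[j ->]|vu] := boolP (v \in codom u).
    by apply: lt_le_trans _ (Dlo j); rewrite mulr_gt0.
  by apply: lt_le_trans _ (Dfar v vu); rewrite mulr_gt0.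
have ratio_lo (j : 'I_k) : (2 * d%:R * shell_scale j)^-1 <= r (u j) / D (u j).
  rewrite ler_pdivlMr// ler_pdivrMl; first exact: Dhi.
  by rewrite !mulr_gt0.
(* The ratio of [v] is at most the inverse of [(3 * d) ^ (j + 1)], that of [u j] at least the
   inverse of [2 * d * (3 * d) ^ j]; strictness comes from [2 < 3]. *)
have Ylt v (j : 'I_k) : shell_scale j.+1 * r v <= D v ->
    Y z v (x v) < Y z (u j) (x (u j)).
  move=> hD; apply: gt0_ltr_powR => //;
    rewrite ?nnegrE ?divr_ge0 ?(ltW (r_gt0 _)) ?(ltW (D_gt0 _)) ?torus_dist_ge0//.
  apply: lt_le_trans _ (ratio_lo j).
  rewrite -/(D v) ltr_pdivrMr// ltr_pdivlMl; last by rewrite !mulr_gt0.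
  apply: lt_le_trans _ hD; rewrite ltr_pM2r// /shell_scale exprS.
  by rewrite ltr_pM2r ?exprn_gt0 ?mulr_gt0// ltr_pM2r// ltr_nat.
have s_gt0 : 0 < powR W T^-1 by exact: powR_gt0.
have -> : nice_seq X u.
  apply/forallP => j; apply/forallP => v; apply/implyP => /forallP vj.
  rewrite /X /X_ !conn_weightE ltr_pM2l//; apply: Ylt.
  (* A variable not drawn lies beyond scale [k >= j + 1]; one drawn later, at [i > j], lies in shell
     [i]. *)
  have [/codomP[i vi]|vu] := boolP (v \in codom u); last first.
    apply: le_trans _ (Dfar v vu); rewrite ler_pM2r//; exact: shell_scale_homo.
  have ji : (j < i)%N.
    by have := vj i; rewrite vi eqxx implybF -ltnNge.
  rewrite vi; apply: le_trans _ (Dlo i); rewrite ler_pM2r//; exact: shell_scale_homo.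
apply: le_trans _ (draw_prob_ge (Y := fun v => Y z v (x v)) k_gt0 uI s_gt0 _ _ alpha_gt0 _).
- rewrite /c0 ler_pM2l// (bigID (fun v => v \in codom u))/=.
  have Hfar : \prod_(v < n | v \notin codom u) H z u v (x v) =
      \prod_(v < n | v \notin codom u) expR (- Y z v (x v)).
    apply: eq_bigr => v vu; rewrite /H (negbTE vu) /far_weight.
    by rewrite (negbTE (fars v vu)) mul1r.
  rewrite Hfar ler_piMl//; first by apply: prodr_ge0 => v _; exact: expR_ge0.
  by apply: prodr_ile1 => v vu; rewrite H_ge0 /H vu -[1]/(1%:R) ler_nat leq_b1.
- by move=> v; exact: conn_weightE.
- by move=> v; exact: powR_ge0.
- move=> j; apply/andP; split.
    apply: ge0_ler_powR; rewrite ?(ltW e_gt0) ?nnegrE ?divr_ge0 ?invr_ge0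
      ?(ltW (r_gt0 _)) ?torus_dist_ge0 ?mulr_ge0 ?(ltW b_gt0)//.
    apply: le_trans _ (ratio_lo j).
    rewrite lef_pV2 ?posrE ?mulr_gt0// ler_pM2l ?mulr_gt0//.
    by apply: shell_scale_homo; exact: ltnW.
  apply: (@le_trans _ _ (powR 1 e)); last by rewrite powR1.
  apply: ge0_ler_powR;
    rewrite ?(ltW e_gt0) ?nnegrE ?divr_ge0 ?(ltW (r_gt0 _)) ?torus_dist_ge0//.
  rewrite -/(D (u j)) ler_pdivrMr// mul1r; apply: le_trans _ (Dlo j).
  by rewrite ler_peMl// ltW.
Qed.
Let pH (u : {ffun 'I_k -> 'I_n}) (v : 'I_n) : R :=
  if v \in codom u then p v else expR (- (2 * A * p v)).

Let A_ge0 : 0 <= A.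
Proof. by apply: far_const_ge0 => //; exact: ltW. Qed.

Let shell_small (j : 'I_k) v : shell_scale j * r v <= 1 / 4.
Proof.
suff : 4 * b * r v <= 1.
  have : shell_scale j * r v <= b * r v.
    by rewrite ler_pM2r//; apply: shell_scale_homo; exact: ltnW.
  lra.
rewrite -(@ler_pXn2r _ d)// ?nnegrE ?mulr_ge0 ?(ltW b_gt0) ?(ltW (r_gt0 _))//.
rewrite expr1n exprMn r_exp; apply: le_trans _ eps_shell.
by rewrite ler_wpM2l ?p_le// exprn_ge0// mulr_ge0// ltW.
Qed.

Let H_int z (u : {ffun 'I_k -> 'I_n}) (v : 'I_n) : in_cube z -> injective u ->
  ((pH u v)%:E <= cube_int d (fun x => (H z u v x)%:E))%E.
Proof.
move=> zc uI; rewrite /pH /H; case: ifPn => [/codomP[j ->]|_].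
  have rho4 : 0 <= shell_scale j * r (u j) <= 1 / 4.
    by rewrite shell_small andbT mulr_ge0// ltW.
  apply: (@le_trans _ _ ((shell_scale j * r (u j)) ^+ d)%:E).
    (* The power of the scale, at least 1, is discarded; what remains is [r ^ d = p]. *)
    by rewrite lee_fin exprMn r_exp ler_peMl ?(ltW (p_gt0 _))// exprn_ege1.
  apply: le_trans (shell_integral d zc rho4) _; apply: le_cube_int => x xc; rewrite lee_fin ler_nat.
  case: (boolP (in_shell _ _ _ _)) => // inj.
  have -> // : [forall i, (u i == u j) ==> in_shell d (shell_scale i * r (u j)) z x].
  by apply/forallP => i; apply/implyP => /eqP/uI ->.
apply: le_trans _ (far_weight_integral pn_gt0 (shell_scale_ge1 k) e_gt_d (r_gt0 v) zc).
rewrite lee_fin r_exp -/A.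
have Ap : 2 * A * p v <= 1.
  apply: le_trans _ eps_far; apply: ler_wpM2l; last exact: p_le.
  by rewrite mulr_ge0// A_ge0.
have Ap0 : 0 <= A * p v by rewrite mulr_ge0// ltW.
(* [expR (- 2 t) <= 1 / (1 + 2 t) <= 1 - t] for [0 <= t <= 1 / 2] *)
have := expR_ge1Dx (2 * A * p v).
move: Ap Ap0; rewrite -mulrA expRN; move: (A * p v) => t t1 t0 le_exp.
have t2 : 0 < 1 + 2 * t by lra.
apply: (@le_trans _ _ (1 + 2 * t)^-1).
  by rewrite lef_pV2 ?posrE ?expR_gt0.
by rewrite -[leLHS]mul1r ler_pdivrMr//; nra.
Qed.

(** The exponents of the variables not drawn add up to at most [2 * A], because [p] sums to 1; this
    makes the bound uniform in [n]. *)
Let prod_pH_ge (u : {ffun 'I_k -> 'I_n}) : injective u ->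
  expR (- (2 * A)) * \prod_(j < k) p (u j) <= \prod_v pH u v.
Proof.
move=> uI; rewrite (bigID (fun v => v \in codom u))/= mulrC.
have -> : \prod_(v < n | v \in codom u) pH u v = \prod_(j < k) p (u j).
  rewrite big_codom_inj//; apply: eq_bigr => j _.
  by rewrite /pH codom_f.
rewrite ler_wpM2l//; first by apply: prodr_ge0 => j _; exact: ltW.
have -> : \prod_(v < n | v \notin codom u) pH u v =
    expR (- (2 * A * \sum_(v < n | v \notin codom u) p v)).
  rewrite mulr_sumr -sumrN expR_sum; apply: eq_bigr => v vu.
  by rewrite /pH (negbTE vu).
rewrite ler_expR lerN2 -[leRHS]mulr1; apply: ler_wpM2l.
  by rewrite mulr_ge0// A_ge0.
apply: (@le_trans _ _ (\sum_v p v)); last by rewrite sum_p.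
rewrite [leRHS](bigID (fun v => v \in codom u))/= lerDr.
by apply: sumr_ge0 => v _; exact: ltW.
Qed.

Let minorant z (x : 'I_n -> nat -> R) : R :=
  \sum_(u : {ffun 'I_k -> 'I_n} | injectiveb u) c0 * \prod_v H z u v (x v).

Let minorant_ge0 z x : 0 <= minorant z x.
Proof.
by apply: sumr_ge0 => u _; rewrite mulr_ge0 ?(ltW c0_gt0)// prodr_ge0.
Qed.

Let minorant_ext z x y : (forall v i, (i < d)%N -> x v i = y v i) ->
  minorant z x = minorant z y.
Proof.
move=> xy; apply: eq_bigr => u _; congr (_ * _); apply: eq_bigr => v _.
by apply: H_ext => i; exact: xy.
Qed.

Let minorant_le z x : in_cube z -> (forall v, in_cube (x v)) ->
  minorant z x <= nice_prob_given k d pn T w z x.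
Proof.
move=> zc xc; rewrite /nice_prob_given big_mkcondr.
by apply: ler_sum => u /injectiveP uI; exact: nice_draw_ge.
Qed.

Let minorant_int z : in_cube z ->
  ((nice_const k d T)%:E <=
    cube_int (n * d) (fun g => (minorant z (var_pos d g))%:E))%E.
Proof.
move=> zc.
apply: (@le_trans _ _ (\sum_(u : {ffun 'I_k -> 'I_n} | injectiveb u)
    c0 * \prod_v pH u v)%:E).
  rewrite lee_fin -mulr_sumr /nice_const -/alpha -/A ler_pM2l//.
  apply: (@le_trans _ _ (expR (- (2 * A)) *
      \sum_(u : {ffun 'I_k -> 'I_n} | injectiveb u) \prod_(j < k) p (u j))).
    rewrite ler_pM2l ?expR_gt0//.
    apply: le_trans _ (sum_injections_ge (eps := eps) _ _).
    - by move: eps_inj; rewrite -mulrA; move: (_ * eps) => t; lra.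
    - by move=> v; rewrite (ltW (p_gt0 v)) p_le.
    - exact: sum_p.
  by rewrite mulr_sumr; apply: ler_sum => u /injectiveP; exact: prod_pH_ge.
apply: cube_int_sum_ge => [u g /injectiveP uI gc|u /injectiveP uI].
  by rewrite mulr_ge0 ?(ltW c0_gt0)// prodr_ge0.
have := cube_int_prod_ge (p := pH u) (F := H z u) (d := d) _ _ _ _.
move=> hprod; rewrite EFinM.
apply: le_trans (lee_wpmul2l _ (hprod _ _ _ _)) _.
- by rewrite lee_fin ltW.
- by move=> v x _; exact: H_ge0.
- by move=> v; rewrite /pH; case: ifP => _; rewrite ?expR_ge0// ltW.
- by move=> v x y; exact: H_ext.
- by move=> v; exact: H_int.
apply: le_trans (cube_int_scale_le _ (ltW c0_gt0) _) _.
  by move=> g gc; rewrite lee_fin prodr_ge0.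
by apply: le_cube_int => g gc; rewrite -EFinM.
Qed.

Let clause_coords (h : nat -> R) (j : nat) : nat -> R := fun i => h (j * d + i)%N.

Let glue (g h : nat -> R) i := if (i < n * d)%N then g i else h (i - n * d)%N.

Let minorant_positions m (j : 'I_m) g h : in_cube g -> in_cube h ->
  minorant (clause_coords h j) (var_pos d g) <=
    nice_prob_given k d pn T w (clause_pos d n (glue g h) j) (var_pos d (glue g h)).
Proof.
move=> gc hc; set x := glue g h; have xc : in_cube x by move=> i; rewrite /x /glue; case: ifP.
have -> : clause_pos d n x j = clause_coords h j.
  apply/funext => i; rewrite /clause_pos /x /glue /clause_coords mulnDl -addnA.
  by rewrite ltnNge leq_addr /= addKn.
rewrite (@minorant_ext _ _ (var_pos d x)); last first.
  move=> v i id_; rewrite /var_pos /x /glue.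
  suff -> : (v * d + i < n * d)%N by [].
  by rewrite (@leq_trans (v.+1 * d))// ?leq_mul2r ?ltn_ord ?orbT// mulSn addnC ltn_add2r.
apply: minorant_le; first by move=> i; exact: hc.
by move=> v i; exact: xc.
Qed.

(** Clause positions are integrated outside, variable positions inside. For fixed clause positions,
    [minorant_int] bounds the inner integral by a constant. *)
Lemma clause_nice_prob_ge m (j : 'I_m) :
  ((nice_const k d T)%:E <= clause_nice_prob k d pn T w j)%E.
Proof.
rewrite /clause_nice_prob mulnDl addnC cube_int_split.
rewrite -(cube_int_cst (m * d)); apply: le_cube_int => h hc.
apply: le_trans (minorant_int (z := clause_coords h j) _) _.
  by move=> i; exact: hc.
by apply: le_cube_int => g gc; rewrite lee_fin; exact: minorant_positions.
Qed.

(** The sum over clauses stays inside the integral; superadditivity points in the right direction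
    for a lower bound. *)
Lemma expected_nice_ge m :
  ((nice_const k d T * m%:R)%:E <= expected_nice m k d pn T w)%E.
Proof.
rewrite /expected_nice mulnDl addnC cube_int_split.
rewrite -(cube_int_cst (m * d)); apply: le_cube_int => h hc.
apply: (@le_trans _ _ (cube_int (n * d) (fun g =>
    (\sum_(j < m) minorant (clause_coords h j) (var_pos d g))%:E))).
  apply: (@le_trans _ _ (\sum_(j < m) nice_const k d T)%:E).
    by rewrite sumr_const card_ord mulr_natr.
  apply: cube_int_sum_ge => [j g _ _|j _]; first exact: minorant_ge0.
  by apply: minorant_int => i; exact: hc.
apply: le_cube_int => g gc; rewrite lee_fin; apply: ler_sum => j _.
exact: minorant_positions.
Qed.

End NiceClause.

(** * The upper bound and the asymptotic statement *)

Lemma expected_nice_le (R : realType) n m k d pn (T : R) (w : 'I_n -> R) :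
  (expected_nice m k d pn T w <= (m%:R)%:E)%E.
Proof.
rewrite -(cube_int_cst ((n + m) * d)); apply: le_cube_int => g gc.
rewrite lee_fin -[X in _ <= X%:R](card_ord m) -sumr_const.
apply: ler_sum => j _; rewrite /nice_prob_given.
have X0 (v : 'I_n) :
    0 <= conn_weight d pn T (w v) (clause_pos d n g j) (var_pos d g v).
  exact: powR_ge0.
by have /andP[] := nice_draws_le1 (k := k) X0.
Qed.

Unset Implicit Arguments.

Theorem mainTheorem10 (R : realType) (k d : nat) (pn : option nat) (T : R)
  (w : forall n : nat, 'I_n -> R) :
  (0 < k)%N -> (0 < d)%N ->
  (forall p, pn = Some p -> (0 < p)%N) ->
  0 < T -> T < 1 ->
  (forall n (v : 'I_n), 1 <= w n v) ->
  (forall n, (0 < n)%N -> exists v : 'I_n, w n v = 1) ->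
  (fun n : nat => (\big[Num.max/0]_(v < n) w n v / \sum_(v < n) w n v : R)) @ \oo --> 0 ->
  exists c : R, 0 < c /\ exists N : nat, forall n : nat, (N <= n)%N ->
    forall m : nat,
      (forall j : 'I_m, (c%:E <= clause_nice_prob k d pn T (w n) j)%E) /\
      ((c * m%:R)%:E <= expected_nice m k d pn T (w n))%E /\
      (expected_nice m k d pn T (w n) <= (m%:R)%:E)%E.
Proof.
move=> k0 d0 pn0 T0 T1 w1 _ wcvg.
have d1 : 1 <= d%:R :> R by rewrite ler1n.
have scale_gt0 : 0 < shell_scale d k :> R.
  by rewrite exprn_gt0// mulr_gt0// (lt_le_trans ltr01).
have far_ge0 : 0 <= far_mass k d T.
  apply: far_const_ge0; first exact: ltW.
  by rewrite ltr_pdivlMr// gtr_pMr// (lt_le_trans ltr01).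
pose A := 2 * far_mass k d T.
pose B : R := 2 * (k * k)%:R.
pose C : R := (4 * shell_scale d k) ^+ d.
have A0 : 0 <= A by rewrite mulr_ge0.
have B0 : 0 <= B by rewrite mulr_ge0.
have C0 : 0 < C by rewrite exprn_gt0// mulr_gt0.
have S0 : 0 < A + B + C by lra.
(* One choice meets all three smallness conditions, as each summand is nonnegative; [C > 0] makes it
   well defined. *)
pose eps := (A + B + C)^-1.
have eps0 : 0 < eps by rewrite invr_gt0.
have Seps : (A + B + C) * eps = 1 by rewrite mulfV// gt_eqF.
exists (nice_const k d T); split.
  rewrite mulr_gt0 ?divr_gt0 ?expR_gt0// exprn_gt0// divr_gt0 ?ltr0n//.
  by rewrite powR_gt0// invr_gt0 !mulr_gt0// (lt_le_trans ltr01).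
have /cvgrPdist_le/(_ eps eps0)[N0 _ hN] := wcvg.
(* The successor forces [n > 0], hence a positive total weight. *)
exists N0.+1 => n nN m.
have n0 : (0 < n)%N by exact: leq_trans nN.
have W0 : 0 <= \sum_(v < n) w n v.
  by apply: sumr_ge0 => v _; exact: le_trans ler01 (w1 _ _).
have small (v : 'I_n) : w n v / (\sum_(v < n) w n v) <= eps.
  have := hN n (ltnW nN); rewrite /= sub0r normrN => /(le_trans (ler_norm _)).
  apply: le_trans; rewrite ler_wpM2r ?invr_ge0//.
  exact: (le_bigmax_cond _ (w n) (erefl : xpredT v)).
have epsA : A * eps <= 1 by nra.
have epsB : B * eps <= 1 by nra.
have epsC : C * eps <= 1 by nra.
split; last split.
- by move=> j; apply: (clause_nice_prob_ge (eps := eps)).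
- exact: (expected_nice_ge (eps := eps)).
- exact: expected_nice_le.
Qed.
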